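(* Let $\mathcal{S}$ be an action-based randomization mechanism, $U$ an uncertainty measure and $p$ a prior on $\mathcal{X}$. There is a total (i.e. with domain $\mathcal{Y}^*$), non-adaptive strategy $\sigma$ such that $I_\sigma(\mathcal{S},p)=I(X;[X])$. Consequently, $I_\star(\mathcal{S},p)=I(X;[X])$.
   Context: An action-based randomization mechanism is a 4-tuple $\mathcal{S}=(\mathcal{X},\mathcal{Y},Act,\{M_a:a\in Act\})$ where $\mathcal{X},\mathcal{Y},Act$ are finite nonempty sets and each $M_a$ is a stochastic $|\mathcal{X}|\times|\mathcal{Y}|$ matrix with entries $p_a(y|x)$. An uncertainty measure is a concave continuous function $U:\mathcal{P}\to\mathbb{R}$, $\mathcal{P}$ the set of probability distributions on $\mathcal{X}$. A strategy is a partial function $\sigma:\mathcal{Y}^*\to Act$ with nonempty prefix-closed domain; finite if its domain is finite; non-adaptive if $\sigma(y^n)=\sigma(w^n)$ whenever $y^n,w^n$ have equal length. The truncation $\sigma\backslash n$ is the restriction of $\sigma$ to sequences of length at most $n$. For a prior $p$ and finite $\sigma$, $p_\sigma$ on $\mathcal{X}\times\mathcal{Y}^*$ is: $p_\sigma(x,\varepsilon)=0$ and $p_\sigma(x,y_1,\dots,y_{j+1})=p(x)\prod_{i=1}^{j+1}p_{a_i}(y_i|x)$ with $a_i=\sigma(y_1\cdots y_{i-1})$ if $y_1\cdots y_j\in\mathrm{dom}(\sigma)$ and $y_1\cdots y_{j+1}\notin\mathrm{dom}(\sigma)$, else $0$. With $(X,Y)\sim p_\sigma$: $I_\sigma(\mathcal{S},p)=U(p)-\sum_{w:\,p_\sigma(w)>0}p_\sigma(w)U(p_\sigma(\cdot|w))$,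 where $p_\sigma(\cdot|w)$ is the conditional distribution of $X$ given $Y=w$. For infinite $\sigma$, $I_\sigma(\mathcal{S},p)=\lim_{l\to\infty}I_{\sigma\backslash l}(\mathcal{S},p)$. $I_\star(\mathcal{S},p)=\sup_\sigma I_\sigma(\mathcal{S},p)$. Indistinguishability: $x\equiv x'$ iff $p_a(\cdot|x)=p_a(\cdot|x')$ for all $a\in Act$. For an equivalence class $c$ of $\equiv$ let $p(c)=\sum_{x\in c}p(x)$ and, if $p(c)>0$, $p(\cdot|c)$ the distribution equal to $p(x)/p(c)$ on $x\in c$ and $0$ elsewhere. $U(X|[X])=\sum_{c:\,p(c)>0}p(c)U(p(\cdot|c))$ and $I(X;[X])=U(p)-U(X|[X])$. *)

(* Defs.v *)
From HB Require Import structures.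
From mathcomp Require Import all_boot all_order all_algebra.
From mathcomp Require Import all_classical all_reals all_analysis.

Set Implicit Arguments.
Unset Strict Implicit.
Unset Printing Implicit Defensive.

Import Order.TTheory GRing.Theory Num.Theory numFieldNormedType.Exports.

Local Open Scope classical_set_scope.
Local Open Scope ring_scope.

Definition prob_distr (R : realType) (T : finType) : set (T -> R) :=
  [set p | (forall x, 0 <= p x) /\ \sum_x p x = 1].
Arguments prob_distr R T : clear implicits.

(* [prob S a x y] is $p_a(y|x)$. *)
Record mechanism (R : realType) (X Y Act : finType) := Mechanism {
  prob : Act -> X -> Y -> R;
  secret_neq0 : (0 < #|X|)%N;
  obs_neq0 : (0 < #|Y|)%N;
  act_neq0 : (0 < #|Act|)%N;
  prob_stochastic : forall a x, prob_distr R Y (prob a x) }.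

(* An uncertainty measure is given by a function on the whole space [X -> R];
   only its values on probability distributions are constrained, or ever used.
   Since [X] is finite, the pointwise topology on [X -> R] is the Euclidean
   one. *)
Definition concave_on (R : realType) (X : finType) (D : set (X -> R))
    (U : (X -> R) -> R) :=
  forall (t : R) (p q : X -> R), 0 <= t -> t <= 1 -> D p -> D q ->
    t * U p + (1 - t) * U q <= U (fun x => t * p x + (1 - t) * q x).

Definition uncertainty_measure (R : realType) (X : finType)
    (U : (X -> R) -> R) :=
  concave_on (prob_distr R X) U /\
  {within (prob_distr R X : set {ptws X -> R}),
    continuous (U : {ptws X -> R} -> R)}.

(* Partial functions are encoded with [option]; [None] means undefined. *)
Definition pdom (Y Act : Type) (f : seq Y -> option Act) : set (seq Y) :=
  [set w | f w <> None].

Record strategy (Y Act : finType) := Strategy {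
  strat :> seq Y -> option Act;
  strat_dom_neq0 : pdom strat !=set0;
  strat_prefix_closed :
    forall v w, prefix v w -> pdom strat w -> pdom strat v }.

Definition finite_strategy (Y Act : finType) (s : strategy Y Act) :=
  finite_set (pdom s).

Definition total_strategy (Y Act : finType) (s : strategy Y Act) :=
  pdom s = setT.

Definition non_adaptive (Y Act : finType) (s : strategy Y Act) :=
  forall v w : seq Y, size v = size w -> s v = s w.

Section Truncation.
Context (Y Act : finType) (s : strategy Y Act) (n : nat).

Definition trunc_fun (w : seq Y) : option Act :=
  if (size w <= n)%N then s w else None.

Lemma trunc_dom_neq0 : pdom trunc_fun !=set0.
Proof.
have [w sw] := strat_dom_neq0 s.
by exists [::]; apply: strat_prefix_closed sw; exact: prefix0s.
Qed.

Lemma trunc_prefix_closed v w :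
  prefix v w -> pdom trunc_fun w -> pdom trunc_fun v.
Proof.
move=> vw; rewrite /pdom /trunc_fun /=; case: ifP => // wn sw.
by rewrite (leq_trans (size_prefix vw) wn); exact: strat_prefix_closed sw.
Qed.

Definition trunc : strategy Y Act :=
  Strategy trunc_dom_neq0 trunc_prefix_closed.

End Truncation.

Section Leakage.
Context (R : realType) (X Y Act : finType) (S : mechanism R X Y Act).
Context (U : (X -> R) -> R) (p : X -> R).
Implicit Types (s : strategy Y Act) (w : seq Y).

(* [take i w] is $y_1\cdots y_i$ and [tnth (in_tuple w) i] is $y_{i+1}$. On the
   words of interest [take i w] is in the domain of [s] for all [i < size w],
   so the value 0 in the product is never used. *)
Definition joint s (x : X) w : R :=
  if [&& w != [::], s (take (size w).-1 w) != None & s w == None] then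
    p x * \prod_(i < size w)
            (if s (take i w) is Some a then prob S a x (tnth (in_tuple w) i)
             else 0)
  else 0.

Definition marg s w : R := \sum_x joint s x w.

Definition post s w : X -> R := fun x => joint s x w / marg s w.

(* For a finite strategy, [marg s w > 0] holds for finitely many [w] only, so
   that the sum below is a genuine one. *)
Definition leak_fin s : R :=
  U p - \sum_(w \in [set w | 0 < marg s w]) marg s w * U (post s w).

(* For an uncertainty measure [U] and a prior [p], concavity makes
   [leak_fin (trunc s l)] nondecreasing and bounded in [l], so the limit always
   exists. *)
Definition leak s : R :=
  if `[< finite_strategy s >] then leak_fin s
  else limn (fun l => leak_fin (trunc s l)).

Definition leak_star : \bar R :=
  ereal_sup [set (leak s)%:E | s in [set: strategy Y Act]].

Definition indist : rel X :=
  fun x x' => [forall a, forall y, prob S a x y == prob S a x' y].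

Definition indist_classes : {set {set X}} :=
  equivalence_partition indist [set: X]%SET.

Definition class_prob (c : {set X}) : R := \sum_(x in c) p x.

Definition class_cond (c : {set X}) : X -> R :=
  fun x => if x \in c then p x / class_prob c else 0.

Definition cond_uncertainty : R :=
  \sum_(c in indist_classes | 0 < class_prob c) class_prob c * U (class_cond c).

Definition class_info : R := U p - cond_uncertainty.

End Leakage.

(* Main.v *)
Require Import Defs.
From mathcomp Require Import all_boot all_order all_algebra.
From mathcomp Require Import all_classical all_reals all_analysis.
From mathcomp Require Import ring lra.

(* Upper bound: the likelihood of a word depends on the secret only through its
   indistinguishability class, so a posterior is a mixture of the class
   conditionals [p(.|c)], and Jensen's inequality bounds the leakage of every
   finite strategy by [I(X;[X])].

   Attainment: play all actions cyclically. For secrets [x], [x'] in different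
   classes, the sum over the words [w] of length [k] of
   [sqrt (P(w|x) * P(w|x'))] is the product of the Bhattacharyya coefficients of
   the [k] actions played, at least one of which per period is bounded away
   from 1; so it tends to 0 geometrically. This sum controls the expected
   posterior mass outside the true class, hence the expected distance of the
   posterior to [p(.|c)]. Continuity of [U] at the finitely many [p(.|c)] and
   boundedness of [U] above then give the converse inequality in the limit. *)

Set Implicit Arguments.
Unset Strict Implicit.
Unset Printing Implicit Defensive.

Import Order.TTheory GRing.Theory Num.Theory numFieldNormedType.Exports.

Local Open Scope classical_set_scope.
Local Open Scope ring_scope.

(** * Concave functions on the simplex: Jensen, bounds, upper semicontinuity *)

Section Uncertainty.
Context (R : realType) (X : finType) (U : (X -> R) -> R).
Implicit Types p q : X -> R.
Notation D := (prob_distr R X).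

Lemma prob_distr_comb (t : R) p q : 0 <= t -> t <= 1 -> D p -> D q ->
  D (fun x => t * p x + (1 - t) * q x).
Proof.
move=> t0 t1 [p0 p1] [q0 q1]; split=> [x|].
  by rewrite addr_ge0// mulr_ge0// subr_ge0.
by rewrite big_split/= -!mulr_sumr p1 q1 !mulr1 addrC subrK.
Qed.

(** Weights are unnormalised, and points of weight zero need not be distributions, so that null
    classes can stay in the sums. In the induction, the mean over [i :: r] combines [f i] and the
    mean over [r] with weight [t i / (t i + s)]. *)
Lemma jensen (I : eqType) (r : seq I) (t : I -> R) (f : I -> X -> R) :
  concave_on D U -> (forall i, 0 <= t i) -> (forall i, 0 < t i -> D (f i)) ->
  let s := \sum_(i <- r) t i in 0 < s ->
  let m := fun x => (\sum_(i <- r) t i * f i x) / s in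
  D m /\ \sum_(i <- r) t i * U (f i) <= s * U m.
Proof.
move=> cU t0 Df; elim: r => [|i r IH] /=; first by rewrite big_nil ltxx.
have sr0 : 0 <= \sum_(j <- r) t j by rewrite sumr_ge0.
have [ti|ti|ti] := ltgtP (t i) 0.
- by move: (t0 i); rewrite leNgt ti.
- rewrite !big_cons => _.
  have [s0|s0] := eqVneq (\sum_(j <- r) t j) 0.
    have z j : j \in r -> t j = 0.
      move=> jr; move/eqP: s0; rewrite psumr_eq0// => /allP/(_ _ jr)/=.
      by move/eqP.
    have -> : (fun x => (\sum_(j <- i :: r) t j * f j x) /
        (t i + \sum_(j <- r) t j)) = f i.
      apply/funext => x; rewrite big_cons s0 addr0 big1_seq ?addr0.
        by rewrite mulrC mulKf// gt_eqF.
      by move=> j /andP[_ /z ->]; rewrite mul0r.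
    rewrite s0 addr0 [X in _ + X]big1_seq ?addr0; first by split => //; exact: Df.
    by move=> j /andP[_ /z ->]; rewrite mul0r.
  have sp : 0 < \sum_(j <- r) t j by rewrite lt_def s0.
  have [Dm Um] := IH sp.
  set s := \sum_(j <- r) t j in sp sr0 s0 Dm Um *.
  set m := (fun x => _) in Dm Um.
  have sP : 0 < t i + s by rewrite addr_gt0.
  have -> : (fun x => (\sum_(j <- i :: r) t j * f j x) / (t i + s)) =
     (fun x => (t i / (t i + s)) * f i x + (1 - t i / (t i + s)) * m x).
    apply/funext => x; rewrite big_cons /m.
    by field; rewrite !gt_eqF.
  have T0 : 0 <= t i / (t i + s) by rewrite divr_ge0// ltW.
  have T1 : t i / (t i + s) <= 1 by rewrite ler_pdivrMr// mul1r lerDl.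
  split; first exact: prob_distr_comb (Df _ ti) Dm.
  have := cU _ _ _ T0 T1 (Df _ ti) Dm.
  rewrite -(ler_pM2l sP); apply: le_trans.
  have -> : (t i + s) * (t i / (t i + s) * U (f i) + (1 - t i / (t i + s)) * U m)
     = t i * U (f i) + s * U m by field; rewrite gt_eqF.
  by rewrite lerD2l.
- rewrite !big_cons ti mul0r !add0r => /IH[Dm Um].
  have -> : (fun x => (\sum_(j <- i :: r) t j * f j x) / (\sum_(j <- r) t j)) =
    (fun x => (\sum_(j <- r) t j * f j x) / (\sum_(j <- r) t j)).
    by apply/funext => x; rewrite big_cons ti mul0r add0r.
  by [].
Qed.

(** A distribution is a mixture of the point masses [e i], so Jensen bounds [U] below by values at
    finitely many points. *)
Lemma concave_bounded_below : concave_on D U ->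
  exists m, forall q, D q -> m <= U q.
Proof.
move=> cU; pose e (i x : X) : R := (i == x)%:R.
have De i : D (e i).
  split=> [x|]; first exact: ler0n.
  rewrite (bigD1 i)//= /e eqxx big1 ?addr0// => j.
  by rewrite eq_sym => /negbTE ->.
exists (- \sum_i `|U (e i)|) => q [q0 q1].
have := @jensen X (index_enum X) q e cU q0 (fun i _ => De i).
rewrite /= q1 => /(_ ltr01)[_].
have -> : (fun x => (\sum_i q i * e i x) / 1) = q.
  apply/funext => x; rewrite divr1 (bigD1 x)//= /e eqxx mulr1 big1 ?addr0//.
  by move=> j /negbTE ->; rewrite mulr0.
rewrite mul1r; apply: le_trans; rewrite -sumrN ler_sum// => i _.
rewrite lerNl -mulrN; apply: le_trans (ler_norm _) _.
rewrite normrM normrN ger0_norm// ler_piMl//.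
by rewrite -q1 (bigD1 i)//= lerDl sumr_ge0.
Qed.

(** Along a segment from [q] through the uniform distribution, the far end has [U] at least [m], so
    a large [U q] would force a large value at the uniform distribution. *)
Lemma concave_bounded_above : concave_on D U ->
  exists M, forall q, D q -> U q <= M.
Proof.
move=> cU; have [m mU] := concave_bounded_below cU.
pose n : R := #|X|%:R.
pose c := fun _ : X => n^-1.
(* Being below [n^-1], this weight keeps [q'] nonnegative; being below 1 even when [n = 1], it
   allows the division by [1 - t]. *)
pose t := (n + 1)^-1.
exists ((n + 1) * (U c - (1 - t) * m)) => q Dq; have [q0 q1] := Dq.
have n0 : 0 < n.
  rewrite ltr0n lt0n; apply/eqP => X0.
  move: q1; rewrite big_pred0 => [/eqP|x]; first by rewrite eq_sym oner_eq0.
  by have := card0_eq X0 x; rewrite !inE.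
have n1 : 0 < n + 1 by rewrite addr_gt0.
have t0 : 0 < t by rewrite invr_gt0.
have t1 : t < 1 by rewrite invf_lt1// ltrDr.
(* The uniform distribution is a combination of [q], with weight [t], and of
   another distribution. *)
pose q' := fun x => (c x - t * q x) / (1 - t).
have Dq' : D q'.
  split=> [x|]; rewrite /q'.
    rewrite divr_ge0 ?subr_ge0 ?(ltW t1)//.
    rewrite (le_trans (y := t))//.
      by rewrite ler_piMr ?(ltW t0)// -q1 (bigD1 x)//= lerDl sumr_ge0.
    by rewrite lef_pV2// lerDl.
  rewrite -mulr_suml sumrB -mulr_sumr q1 sumr_const -[X in X - _]mulr_natl.
  by rewrite mulfV ?gt_eqF// mulr1 divff// subr_eq0 gt_eqF.
have := cU t q q' (ltW t0) (ltW t1) Dq Dq'.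
have -> : (fun x => t * q x + (1 - t) * q' x) = c.
  apply/funext => x; rewrite /q' [(1 - t) * _]mulrC divfK ?subr_eq0 ?gt_eqF//.
  by ring.
move=> h; rewrite -ler_pdivrMl// -/t lerBrDr (le_trans _ h)// lerD2l.
by rewrite ler_pM2l ?mU// subr_gt0.
Qed.

(** For [r < d] continuity suffices; for [r >= d] the slope [K] is steep enough for the global bound
    on [U]. A bound affine in [r] can be averaged over words. *)
Lemma usc_affine p (e : R) : uncertainty_measure U -> D p -> 0 < e ->
  exists2 K, 0 <= K & forall q r, D q -> (forall x, `|q x - p x| <= r) ->
    U q <= U p + e + K * r.
Proof.
move=> [cU kU] Dp e0; have [M MU] := concave_bounded_above cU.
pose box (d : R) := [set q : {ptws X -> R} | forall x, `|q x - p x| < d].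
pose G := filter_from [set d : R | 0 < d] box.
have FG : Filter G.
  apply: filter_from_filter; first by exists 1 => /=.
  move=> i j /= i0 j0; exists (Num.min i j); first by rewrite lt_min i0.
  by move=> q qb; split=> x; have := qb x; rewrite lt_min => /andP[].
(* The pointwise topology is a supremum of topologies induced by the coordinates, so convergence is
   checked at each [x]. *)
have GP : G --> (p : {ptws X -> R}).
  apply/cvg_sup => x; rewrite cvg_image; last first.
    by rewrite eqEsubset; split => [//|v _]; exists (cst v).
  move=> W /nbhs_ballP[d /= d0 dW].
  exists (@^~ x @^-1` W); last first.
    by rewrite eqEsubset; split => [j [? + <-//]|j Wj]; exists (fun=> j).
  exists d => //= q qb; apply: dW; rewrite /ball/= distrC; exact: qb.
have := (subspace_continuousP (prob_distr R X : set {ptws X -> R}) U).1 kU p Dp.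
move/cvgrPdist_lt => /(_ e e0); rewrite near_withinE => /GP[d /= d0 bd].
exists (`|M - U p| / d); first by rewrite divr_ge0// ltW.
move=> q r Dq qr; have [rd|dr] := ltP r d.
  have /bd/(_ Dq) : box d q by move=> x; rewrite (le_lt_trans (qr x)).
  rewrite distrC ltr_distl => /andP[_ /ltW h]; rewrite (le_trans h)// lerDl.
  (* A point of [X] is what yields [0 <= r] from the distance bounds. *)
  have [x _] : exists x : X, True.
    apply: contrapT => nX; move: Dp.2.
    rewrite big1 ?(eq_sym 0)//; last by move=> x _; case: nX; exists x.
    by move/eqP; rewrite eq_sym oner_eq0.
  by rewrite mulr_ge0 ?divr_ge0 ?(ltW d0)//; exact: le_trans (qr x).
rewrite (le_trans (MU _ Dq))// -addrA -lerBlDl (le_trans (ler_norm _))//.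
rewrite -mulrA [_^-1 * _]mulrC; apply: (@le_trans _ _ (`|M - U p| * (r / d))).
  by rewrite ler_peMr// ler_pdivlMr// mul1r.
by rewrite lerDr ltW.
Qed.

End Uncertainty.

(** * Finite enumerations of words *)

Section Words.
Context (Y : finType).
Implicit Types (w : seq Y) (y : Y).

Fixpoint words k : seq (seq Y) :=
  if k is k'.+1 then [seq rcons w y | w <- words k', y <- enum Y] else [:: [::]].

(** The bound is strict: these are the words of length less than [n]. *)
Definition words_upto n : seq (seq Y) := flatten [seq words k | k <- iota 0 n].

Lemma mem_words k w : (w \in words k) = (size w == k).
Proof.
elim: k w => [|k IH] w; first by rewrite inE size_eq0.
apply/allpairsP/idP => /=.
  by move=> [[v y] /= [vk _ ->]]; rewrite size_rcons eqSS -IH.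
elim/last_ind: w => // v y _; rewrite size_rcons eqSS -IH => vk.
by exists (v, y); rewrite mem_enum.
Qed.

Lemma uniq_words k : uniq (words k).
Proof.
elim: k => //= k IH; apply: allpairs_uniq => //; first exact: enum_uniq.
by move=> [v y] [v' y'] _ _ /= /rcons_inj[-> ->].
Qed.

Lemma words_uptoS n : words_upto n.+1 = words_upto n ++ words n.
Proof. by rewrite /words_upto -addn1 iotaD map_cat flatten_cat /= cats0. Qed.

Lemma mem_words_upto n w : (w \in words_upto n) = (size w < n)%N.
Proof.
elim: n => // n IH; rewrite words_uptoS mem_cat IH mem_words ltnS.
by rewrite [in RHS]leq_eqVlt orbC.
Qed.

Lemma uniq_words_upto n : uniq (words_upto n).
Proof.
elim: n => // n IH; rewrite words_uptoS cat_uniq IH uniq_words andbT /=.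
by apply/hasPn => w; rewrite mem_words mem_words_upto => /eqP ->; rewrite ltnn.
Qed.

Lemma sum_wordsS (R : realType) k (F : seq Y -> R) :
  \sum_(w <- words k.+1) F w = \sum_(w <- words k) \sum_y F (rcons w y).
Proof.
rewrite /= big_flatten big_map; apply: eq_bigr => w _.
by rewrite big_map big_enum.
Qed.

Lemma finite_strategy_bounded (Act : finType) (s : strategy Y Act) :
  finite_strategy s ->
  exists n, forall w, s w != None -> (size w <= n)%N.
Proof.
move=> /finite_seqP[r Dr]; exists (\max_(w <- r) size w) => w sw.
have wr : w \in r.
  have : pdom s w by move=> s0; rewrite s0 in sw.
  by rewrite Dr.
exact: (leq_bigmax_seq (F := size)).
Qed.

End Words.

(** * Indistinguishability classes and their conditional distributions *)

Section Classes.
Context (R : realType) (X Y Act : finType) (S : mechanism R X Y Act).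
Context (U : (X -> R) -> R) (p : X -> R).
Context (pD : prob_distr R X p).

Definition class_of x : {set X} := [set x' | indist S x x']%SET.

Lemma indistP x x' : reflect (forall a, prob S a x = prob S a x') (indist S x x').
Proof.
apply: (iffP idP) => [/forallP h a|h].
  by apply/funext => y; have /forallP/(_ y)/eqP := h a.
by apply/forallP => a; apply/forallP => y; rewrite h.
Qed.

Lemma indist_equiv : {in [set: X]%SET & &, equivalence_rel (indist S)}.
Proof.
move=> x y z _ _ _; split; first exact/indistP.
by move=> /indistP xy; apply/indistP/indistP => h a; rewrite -h xy.
Qed.

Lemma class_of_eq x x' : indist S x x' -> class_of x = class_of x'.
Proof.
move=> /indistP xx'; apply/setP => z; rewrite !inE.
by apply/indistP/indistP => h a; rewrite -h xx'.
Qed.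

Lemma indist_sym x x' : indist S x x' = indist S x' x.
Proof. by apply/indistP/indistP => h a; rewrite h. Qed.

Lemma class_prob_ge0 c : 0 <= class_prob p c.
Proof. by apply: sumr_ge0 => x _; exact: pD.1. Qed.

Lemma le_class_prob x : p x <= class_prob p (class_of x).
Proof.
rewrite /class_prob (bigD1 x) ?inE /=; last exact/indistP.
by rewrite lerDl sumr_ge0// => i _; exact: pD.1.
Qed.

(** Each [p(c)] is distributed over the members of [c]; in a class of probability zero every member
    has prior zero. *)
Lemma cond_uncertaintyE :
  cond_uncertainty S U p = \sum_x p x * U (class_cond p (class_of x)).
Proof.
transitivity (\sum_(x in [set: X]%SET) p x * U (class_cond p (class_of x)));
  last by apply: eq_bigl => x; rewrite inE.
rewrite (set_partition_big _ (equivalence_partitionP indist_equiv)).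
rewrite /cond_uncertainty big_mkcondr; apply: eq_bigr => c cP.
case: ifPn => [c0|].
  rewrite mulr_suml; apply: eq_bigr => x xc; congr (_ * U (class_cond _ _)).
  move: cP xc => /imsetP[x0 _ ->]; rewrite inE => /andP[_ /class_of_eq <-].
  by apply/setP => z; rewrite !inE.
rewrite lt_def class_prob_ge0 andbT negbK => /eqP c0.
rewrite big1// => x xc; suff -> : p x = 0 by rewrite mul0r.
move/eqP: c0; rewrite psumr_eq0 => [/allP/(_ x)|i _]; last exact: pD.1.
by rewrite mem_index_enum xc => /(_ isT)/eqP.
Qed.

Lemma class_cond_distr x : 0 < p x -> prob_distr R X (class_cond p (class_of x)).
Proof.
move=> px; have c0 := lt_le_trans px (le_class_prob x); split=> [z|].
  rewrite /class_cond; case: ifP => // _.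
  by rewrite divr_ge0 ?(ltW c0)//; exact: pD.1.
by rewrite -big_mkcond/= -mulr_suml divff// gt_eqF.
Qed.

(** Only the [i] in the class of [x] contribute; there [g] is constant and the prior masses sum to
    the normalising factor of [p(.|c)]. *)
Lemma class_mix (g : X -> R) x :
  (forall x x', indist S x x' -> g x = g x') ->
  \sum_i p i * g i * class_cond p (class_of i) x = p x * g x.
Proof.
move=> gc; have [px|px] := eqVneq (p x) 0.
  rewrite px mul0r big1// => i _; rewrite /class_cond px.
  by case: ifP; rewrite ?mul0r mulr0.
have c0 : 0 < class_prob p (class_of x).
  by rewrite (lt_le_trans _ (le_class_prob x))// lt_def px; exact: pD.1.
transitivity (\sum_(i in class_of x) p i * (g x * p x / class_prob p (class_of x))).
  rewrite [RHS]big_mkcond; apply: eq_bigr => i _; rewrite /class_cond !inE.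
  rewrite indist_sym; case: ifP => [xi|_]; last by rewrite mulr0.
  by rewrite (gc _ _ xi) -(class_of_eq xi); ring.
rewrite -mulr_suml -/(class_prob p (class_of x)).
by field; rewrite gt_eqF.
Qed.

(** With [g] the likelihood of a word, [m] is its marginal and the distribution is the posterior,
    which [class_mix] writes as a mixture of class conditionals. *)
Lemma class_jensen (g : X -> R) : concave_on (prob_distr R X) U ->
  (forall x, 0 <= g x) -> (forall x x', indist S x x' -> g x = g x') ->
  let m := \sum_x p x * g x in 0 < m ->
  prob_distr R X (fun x => p x * g x / m) /\
  \sum_x p x * g x * U (class_cond p (class_of x)) <=
    m * U (fun x => p x * g x / m).
Proof.
move=> cU g0 gc m m0.
have := @jensen R X U X (index_enum X) (fun x => p x * g x)
   (fun x => class_cond p (class_of x)) cU.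
rewrite /=.
have -> : (fun x => (\sum_i p i * g i * class_cond p (class_of i) x) /
   (\sum_i p i * g i)) = (fun x => p x * g x / m).
  by apply/funext => x; rewrite class_mix.
apply => //; first by move=> i; rewrite mulr_ge0//; exact: pD.1.
move=> i pg; apply: class_cond_distr; rewrite lt_def pD.1 andbT.
by apply: contraTneq pg => ->; rewrite mul0r ltxx.
Qed.

End Classes.

(** * Likelihoods of words and the upper bound for finite strategies *)

Section Likelihood.
Context (R : realType) (X Y Act : finType) (S : mechanism R X Y Act).
Context (s : strategy Y Act).
Implicit Types (x : X) (w : seq Y) (y : Y).

Definition path_prob x w : R := \prod_(i < size w)
  (if s (take i w) is Some a then prob S a x (tnth (in_tuple w) i) else 0).

(** The words at which the run halts: just outside the domain, with their longest proper prefix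
    inside. *)
Definition stopped w := [&& w != [::], s (take (size w).-1 w) != None & s w == None].

Definition lik x w : R := if stopped w then path_prob x w else 0.

Lemma jointE p x w : joint S p s x w = p x * lik x w.
Proof. by rewrite /joint /lik /stopped; case: ifP; rewrite ?mulr0. Qed.

Lemma path_prob_ge0 x w : 0 <= path_prob x w.
Proof.
apply: prodr_ge0 => i _; case: (s _) => // a; exact: (prob_stochastic S a x).1.
Qed.

Lemma lik_ge0 x w : 0 <= lik x w.
Proof. by rewrite /lik; case: ifP => // _; exact: path_prob_ge0. Qed.

Lemma lik_indist x x' w : indist S x x' -> lik x w = lik x' w.
Proof.
move=> /indistP h; rewrite /lik /path_prob; case: ifP => // _.
by apply: eq_bigr => i _; case: (s _) => // a; rewrite h.
Qed.

Lemma path_prob_rcons x w y : path_prob x (rcons w y) =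
  path_prob x w * (if s w is Some a then prob S a x y else 0).
Proof.
have pathE v : path_prob x v = \prod_(i < size v)
    (if s (take i v) is Some a then prob S a x (nth y v i) else 0).
  by apply: eq_bigr => i _; rewrite (tnth_nth y).
rewrite !pathE size_rcons big_ord_recr /= nth_rcons ltnn eqxx.
rewrite -cats1 takel_cat// take_size; congr (_ * _).
apply: eq_bigr => i _.
by rewrite takel_cat ?(ltnW (ltn_ord i))// nth_cat ltn_ord.
Qed.

Lemma stopped_rcons w y :
  stopped (rcons w y) = (s w != None) && (s (rcons w y) == None).
Proof.
rewrite /stopped size_rcons /= -cats1 takel_cat// take_size.
by case: w.
Qed.

Lemma strat_nil : s [::] != None.
Proof.
have [w sw] := strat_dom_neq0 s.
by apply/eqP; apply: strat_prefix_closed sw; exact: prefix0s.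
Qed.

(* A word of length [k] in the domain either stops one step later or is still
   in the domain. *)
Lemma sum_lik_upto x k : \sum_(w <- words_upto Y k.+1) lik x w +
  \sum_(w <- words Y k) (s w != None)%:R * path_prob x w = 1.
Proof.
elim: k => [|k IH].
  rewrite /words_upto /= !big_seq1 /lik /stopped /= add0r strat_nil mul1r.
  by rewrite /path_prob big_ord0.
rewrite words_uptoS big_cat -addrA -[RHS]IH; congr (_ + _).
rewrite -big_split sum_wordsS; apply: eq_bigr => w _ /=.
transitivity (\sum_y path_prob x w * (if s w is Some a then prob S a x y else 0)).
  apply: eq_bigr => y _; rewrite /lik stopped_rcons path_prob_rcons.
  by case: (s w) => [a|] /=; case: (s (rcons w y)) => [b|] /=;
    rewrite ?mulr0 ?mul1r ?mul0r ?addr0 ?add0r.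
rewrite -mulr_sumr; case: (s w) => [a|] /=.
  by rewrite (prob_stochastic S a x).2 mulr1 mul1r.
by rewrite big1// mulr0 mul0r.
Qed.

Context (n : nat) (sn : forall w, s w != None -> (size w <= n)%N).

Lemma sum_lik x : \sum_(w <- words_upto Y n.+2) lik x w = 1.
Proof.
(* Runs stop at length at most [n.+1], and [words_upto] is strict, hence [n.+2]; no word of length
   [n.+1] is left in the domain. *)
rewrite -[RHS](sum_lik_upto x n.+1) [X in _ + X]big1_seq ?addr0// => w.
rewrite mem_words => /andP[_ /eqP wn].
have -> : s w = None; last by rewrite mul0r.
by apply: contraTeq isT => /sn; rewrite wn ltnn.
Qed.

Context (U : (X -> R) -> R) (p : X -> R) (pD : prob_distr R X p).

Lemma margE w : marg S p s w = \sum_x p x * lik x w.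
Proof. by apply: eq_bigr => x _; rewrite jointE. Qed.

Lemma marg_ge0 w : 0 <= marg S p s w.
Proof.
by rewrite margE sumr_ge0// => x _; rewrite mulr_ge0 ?lik_ge0//; exact: pD.1.
Qed.

Lemma postE w : post S p s w = fun x => p x * lik x w / marg S p s w.
Proof. by apply/funext => x; rewrite /post jointE. Qed.

Lemma leak_finE : leak_fin S U p s =
  U p - \sum_(w <- words_upto Y n.+2) marg S p s w * U (post S p s w).
Proof.
congr (_ - _); rewrite [RHS]fsbig_seq ?uniq_words_upto//.
apply: fsbig_widen => [w /= w0|w /= [_ /negP]].
  rewrite mem_words_upto ltnS; apply: contraTT w0; rewrite -ltnNge => nw.
  rewrite -leNgt margE big1// => x _; rewrite /lik /stopped.
  case: ifPn; rewrite ?mulr0// => /and3P[_ /sn + _].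
  by rewrite size_takel ?leq_pred// leqNgt -ltnS (ltn_predK nw) nw.
by rewrite lt_def marg_ge0 andbT negbK => /eqP ->; rewrite mul0r.
Qed.

Lemma leak_fin_le : concave_on (prob_distr R X) U ->
  leak_fin S U p s <= class_info S U p.
Proof.
move=> cU; rewrite leak_finE /class_info lerD2l lerN2 (cond_uncertaintyE _ _ pD).
(* Since likelihoods sum to 1, each [p x] splits over the words, and the comparison becomes Jensen
   word by word. *)
have -> : \sum_x p x * U (class_cond p (class_of S x)) =
  \sum_(w <- words_upto Y n.+2)
    \sum_x p x * lik x w * U (class_cond p (class_of S x)).
  rewrite exchange_big; apply: eq_bigr => x _ /=.
  rewrite -mulr_suml -mulr_sumr sum_lik mulr1//.
apply: ler_sum => w _; have [m0|m0] := eqVneq (marg S p s w) 0.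
  rewrite m0 mul0r big1// => x _; move/eqP: m0.
  rewrite margE psumr_eq0 => [/allP/(_ x)|i _]; last first.
    by rewrite mulr_ge0 ?lik_ge0//; exact: pD.1.
  by rewrite mem_index_enum => /(_ isT)/eqP ->; rewrite mul0r.
rewrite postE margE; apply: (class_jensen (S := S) pD cU _ _ _).2 => [x|x x' xx'|].
- exact: lik_ge0.
- exact: lik_indist.
- by rewrite -margE lt_def m0 marg_ge0.
Qed.

End Likelihood.

(** * Concentration of the posterior and the lower bound on leakage *)

Section Posterior.
Context (R : realType) (X Y Act : finType) (S : mechanism R X Y Act).
Context (U : (X -> R) -> R) (p : X -> R).
Context (hU : uncertainty_measure U) (pD : prob_distr R X p).
Notation cc x := (class_cond p (class_of S x)).
Implicit Types s : strategy Y Act.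

Lemma le_prior1 x : p x <= 1.
Proof. by rewrite -pD.2 (bigD1 x)//= lerDl sumr_ge0// => i _; exact: pD.1. Qed.

Lemma prior_lik_ge0 s x w : 0 <= p x * lik S s x w.
Proof. by rewrite mulr_ge0 ?lik_ge0//; exact: pD.1. Qed.

Lemma post_distr s w : 0 < marg S p s w -> prob_distr R X (post S p s w).
Proof.
move=> m0; split=> [x|]; first by rewrite postE divr_ge0 ?prior_lik_ge0 ?ltW.
by rewrite postE -mulr_suml -margE divff// gt_eqF.
Qed.

(* On the class of [x] the posterior is proportional to [cc x], so its distance
   to [cc x] is at most the mass it leaves outside that class. *)
Lemma post_class_dist s w x z : 0 < p x -> 0 < marg S p s w ->
  `|post S p s w z - cc x z| <= \sum_(x' | ~~ indist S x x') post S p s w x'.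
Proof.
move=> px m0; have [po0 po1] := post_distr m0.
have c0 : 0 < class_prob p (class_of S x).
  by rewrite (lt_le_trans px)// le_class_prob.
set r := \sum_(x' | _) _.
have r0 : 0 <= r by rewrite sumr_ge0.
rewrite /class_cond inE; case: ifPn => [xz|xz]; last first.
  by rewrite subr0 ger0_norm// /r (bigD1 z)//= lerDl sumr_ge0.
have e : 1 - r = class_prob p (class_of S x) * lik S s x w / marg S p s w.
  rewrite -po1 (bigID (indist S x))/= addrK !mulr_suml.
  apply: eq_big => x'; first by rewrite inE.
  by move=> xx'; rewrite postE (lik_indist s w xx').
have -> : post S p s w z - p z / class_prob p (class_of S x) =
    - (p z / class_prob p (class_of S x) * r).
  have -> : r = 1 - class_prob p (class_of S x) * lik S s x w / marg S p s w.
    by rewrite -e; ring.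
  by rewrite postE (lik_indist s w xz); field; rewrite !gt_eqF.
rewrite normrN ger0_norm; last by rewrite mulr_ge0// divr_ge0 ?(ltW c0)//; exact: pD.1.
rewrite ler_piMl// ler_pdivrMr// mul1r.
apply: le_trans (le_class_prob S pD z) _.
by rewrite (class_of_eq xz).
Qed.

(** The left side is [a * b / m]. As [a] and [b] are both at most [m], so is their geometric mean,
    whence [a * b / m <= sqrt (a * b)]; the priors are then bounded by 1. *)
Lemma joint_post_le s w x x' : x != x' ->
  p x * lik S s x w * post S p s w x' <=
  Num.sqrt (lik S s x w * lik S s x' w).
Proof.
move=> xx'; set a := p x * lik S s x w; rewrite postE.
set b := p x' * lik S s x' w; set m := marg S p s w.
have a0 : 0 <= a := prior_lik_ge0 s x w.
have b0 : 0 <= b := prior_lik_ge0 s x' w.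
have am : a <= m.
  by rewrite /m margE (bigD1 x)//= lerDl sumr_ge0// => i _; exact: prior_lik_ge0.
have bm : b <= m.
  by rewrite /m margE (bigD1 x')//= lerDl sumr_ge0// => i _; exact: prior_lik_ge0.
have m0 : 0 <= m := le_trans a0 am.
have sab : Num.sqrt (a * b) <= m.
  rewrite -[m]ger0_norm// -sqrtr_sqr; apply: ler_wsqrtr.
  by rewrite expr2; apply: ler_pM.
apply: (@le_trans _ _ (Num.sqrt (a * b))).
  have [->|mn0] := eqVneq m 0; first by rewrite invr0 !mulr0 sqrtr_ge0.
  rewrite mulrA ler_pdivrMr ?lt_def ?mn0//.
  have {1}-> : a * b = Num.sqrt (a * b) * Num.sqrt (a * b).
    by rewrite -expr2 sqr_sqrtr// mulr_ge0.
  by rewrite ler_wpM2l ?sqrtr_ge0.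
apply: ler_wsqrtr; apply: ler_pM => //.
  by rewrite ler_piMl ?lik_ge0// le_prior1.
by rewrite ler_piMl ?lik_ge0// le_prior1.
Qed.

(** [K] is chosen before [s] and [n], so one error bound serves all truncations of a strategy. *)
Lemma leak_fin_ge (e : R) : 0 < e -> exists2 K : X -> R, (forall x, 0 <= K x) &
  forall s n, (forall w, s w != None -> (size w <= n)%N) ->
  class_info S U p - e - \sum_x K x * \sum_(x' | ~~ indist S x x')
    \sum_(w <- words_upto Y n.+2) Num.sqrt (lik S s x w * lik S s x' w)
  <= leak_fin S U p s.
Proof.
move=> e0.
have /choice[K KP] x : exists k, 0 <= k /\ (0 < p x -> forall q r,
    prob_distr R X q -> (forall z, `|q z - cc x z| <= r) ->
    U q <= U (cc x) + e + k * r).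
  (* When [p x = 0] the class conditional may fail to be a distribution, and the bound is not
     demanded. *)
  have [px|px] := ltP 0 (p x); last by exists 0.
  have [k k0 kP] := usc_affine hU (class_cond_distr S pD px) e0.
  by exists k.
exists K => [x|s n sn]; first exact: (KP x).1.
rewrite (leak_finE S sn U pD) /class_info (cond_uncertaintyE _ _ pD).
rewrite -!addrA lerD2l -!opprD lerN2.
(* The constant [e] is spread over all pairs of a secret and a word, whose joint masses sum to 1. *)
have -> : \sum_x p x * U (cc x) + (e + \sum_x K x * \sum_(x' | ~~ indist S x x')
    \sum_(w <- words_upto Y n.+2) Num.sqrt (lik S s x w * lik S s x' w)) =
  \sum_(w <- words_upto Y n.+2) \sum_x (p x * lik S s x w * (U (cc x) + e) +
    K x * \sum_(x' | ~~ indist S x x') Num.sqrt (lik S s x w * lik S s x' w)).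
  rewrite exchange_big addrA -[X in _ + X + _](mul1r e) -pD.2 mulr_suml.
  rewrite -!big_split; apply: eq_bigr => x _ /=.
  rewrite big_split -!mulr_suml -!mulr_sumr (sum_lik S sn) mulr1 mulrDr.
  by congr (_ + _ * _); rewrite exchange_big.
apply: ler_sum => w _; rewrite {1}margE mulr_suml; apply: ler_sum => x _.
set a := p x * _.
have a0 : 0 <= a := prior_lik_ge0 s x w.
have [->|an0] := eqVneq a 0.
  rewrite !mul0r add0r mulr_ge0 ?(KP x).1//.
  by rewrite sumr_ge0// => i _; exact: sqrtr_ge0.
have ap : 0 < a by rewrite lt_def an0.
have px : 0 < p x.
  by rewrite lt_def pD.1 andbT; apply: contraNneq an0; rewrite /a => ->; rewrite mul0r.
have m0 : 0 < marg S p s w.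
  rewrite (lt_le_trans ap)// margE (bigD1 x)//= lerDl sumr_ge0// => i _.
  exact: prior_lik_ge0.
(* Here [r] is the posterior mass outside the class of [x]. *)
have := (KP x).2 px _ _ (post_distr m0) (fun z => post_class_dist z px m0).
move=> /(ler_wpM2l a0) h; apply: le_trans h _.
rewrite mulrDr lerD2l mulrCA ler_wpM2l ?(KP x).1// mulr_sumr.
apply: ler_sum => x' xx'; apply: joint_post_le.
by apply: contraNneq xx' => ->; apply/indistP.
Qed.

End Posterior.

(** * Bhattacharyya coefficients and geometric decay *)

Section Overlap.
Context (R : realType) (X Y Act : finType) (S : mechanism R X Y Act).

(* The Bhattacharyya coefficient of the two output distributions. *)
Definition overlap a x x' : R := \sum_y Num.sqrt (prob S a x y * prob S a x' y).

Lemma overlap_ge0 a x x' : 0 <= overlap a x x'.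
Proof. by apply: sumr_ge0 => y _; exact: sqrtr_ge0. Qed.

(** The subtracted term is the squared Hellinger distance, which vanishes only for equal
    distributions. *)
Lemma overlapE a x x' : overlap a x x' =
  1 - (\sum_y (Num.sqrt (prob S a x y) - Num.sqrt (prob S a x' y)) ^+ 2) / 2.
Proof.
have [p0 p1] := prob_stochastic S a x; have [q0 q1] := prob_stochastic S a x'.
have -> : \sum_y (Num.sqrt (prob S a x y) - Num.sqrt (prob S a x' y)) ^+ 2 =
    \sum_y prob S a x y - 2 * overlap a x x' + \sum_y prob S a x' y.
  rewrite mulr_sumr -sumrB -big_split; apply: eq_bigr => y _ /=.
  by rewrite sqrrB !sqr_sqrtr// sqrtrM//; ring.
by rewrite p1 q1; field.
Qed.

Lemma overlap_le1 a x x' : overlap a x x' <= 1.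
Proof.
rewrite overlapE lerBlDr lerDl divr_ge0// sumr_ge0// => y _; exact: sqr_ge0.
Qed.

Lemma overlap_lt1 a x x' : prob S a x <> prob S a x' -> overlap a x x' < 1.
Proof.
move=> xx'; rewrite lt_neqAle overlap_le1 andbT; apply: contra_notN xx'.
rewrite overlapE -subr_eq0 addrAC subrr add0r oppr_eq0 mulf_eq0 invr_eq0.
rewrite pnatr_eq0 orbF psumr_eq0 => [/allP h|y _]; last exact: sqr_ge0.
apply/funext => y; have := h y (mem_index_enum y).
rewrite sqrf_eq0 subr_eq0 => /eqP e.
rewrite -[LHS]sqr_sqrtr ?e ?sqr_sqrtr//; exact: (prob_stochastic _ _ _).1.
Qed.

End Overlap.

(** Cut the product into blocks of length [m]: each contains one factor at most [rho], and all other
    factors, including the incomplete last block, are at most 1. *)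
Lemma prod_periodic_le (R : realType) (b : nat -> R) (m j : nat) (rho : R) :
  (forall i, 0 <= b i <= 1) -> (j < m)%N ->
  (forall n, b (n * m + j)%N <= rho) ->
  forall k, \prod_(i < k) b i <= rho ^+ (k %/ m).
Proof.
move=> b01 jm brho k.
have rho0 : 0 <= rho.
  by apply: le_trans (brho 0%N); have /andP[] := b01 (0 * m + j)%N.
have prod_ge0 (r : nat) (f : 'I_r -> nat) : 0 <= \prod_(i < r) b (f i).
  by apply: prodr_ge0 => i _; have /andP[] := b01 (f i).
have blocks n : \prod_(i < n * m) b i <= rho ^+ n.
  elim: n => [|n IH]; first by rewrite mul0n big_ord0 expr0.
  rewrite mulSn addnC big_split_ord /= exprSr.
  apply: ler_pM => //; [exact: prod_ge0 | exact: prod_ge0 |].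
  rewrite (bigD1 (Ordinal jm))//= -[leRHS]mulr1.
  apply: ler_pM => //; last exact: prodr_ile1.
  - by have /andP[] := b01 (n * m + j)%N.
  - by apply: prodr_ge0 => i _; have /andP[] := b01 (n * m + i)%N.
have -> : \prod_(i < k) b i = \prod_(i < k %/ m * m + k %% m) b i.
  by rewrite -divn_eq.
rewrite big_split_ord /= -[leRHS]mulr1.
by apply: ler_pM => //; [exact: prod_ge0 | exact: prod_ge0 | exact: blocks | exact: prodr_ile1].
Qed.

Lemma cvg_expr_divn (R : realType) (rho : R) m : 0 <= rho < 1 -> (0 < m)%N ->
  (fun k => rho ^+ (k %/ m)) @ \oo --> (0 : R).
Proof.
move=> /andP[rho0 rho1] m0.
have : (fun k => (k %/ m)%N) @ \oo --> \oo.
  apply/cvgnyPge => A; exists (A * m)%N => //= k /= ?.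
  by rewrite leq_divRL.
move=> /cvg_comp; apply; apply: cvg_expr; by rewrite ger0_norm.
Qed.

(** * The cyclic strategy *)

Section Cyclic.
Context (R : realType) (X Y Act : finType) (S : mechanism R X Y Act).
Context (a0 : Act).

(** [a0] makes [Act] nonempty, so the index is in range; it also serves as the default of [nth]. *)
Definition cyclic_action k := nth a0 (enum Act) (k %% #|Act|).

Definition cyclic_fun (w : seq Y) : option Act := Some (cyclic_action (size w)).

Lemma cyclic_dom_neq0 : pdom cyclic_fun !=set0.
Proof. by exists [::]. Qed.

Lemma cyclic_prefix_closed (v w : seq Y) :
  prefix v w -> pdom cyclic_fun w -> pdom cyclic_fun v.
Proof. by []. Qed.

Definition cyclic : strategy Y Act :=
  Strategy cyclic_dom_neq0 cyclic_prefix_closed.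

Lemma cyclic_total : total_strategy cyclic.
Proof. exact/seteqP. Qed.

Lemma cyclic_non_adaptive : non_adaptive cyclic.
Proof. by move=> v w vw /=; rewrite /cyclic_fun vw. Qed.

Lemma trunc_cyclicE l w :
  trunc cyclic l w = if (size w <= l)%N then Some (cyclic_action (size w)) else None.
Proof. by []. Qed.

(** The action depends on the length alone, so summing over the last letter factors out one
    coefficient. For [k <= l.+1] all proper prefixes lie in the truncated domain. *)
Lemma sum_sqrt_path_prob l k x x' : (k <= l.+1)%N ->
  \sum_(w <- words Y k)
    Num.sqrt (path_prob S (trunc cyclic l) x w * path_prob S (trunc cyclic l) x' w) =
  \prod_(i < k) overlap S (cyclic_action i) x x'.
Proof.
elim: k => [_|k IH kl].
  by rewrite big_seq1 /path_prob !big_ord0 mulr1 sqrtr1.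
rewrite sum_wordsS big_ord_recr /= -IH ?(ltnW kl)// mulr_suml.
apply: eq_big_seq => w; rewrite mem_words => /eqP wk /=.
rewrite mulr_sumr; apply: eq_bigr => y _.
rewrite !path_prob_rcons trunc_cyclicE wk -ltnS kl -sqrtrM ?mulr_ge0 ?path_prob_ge0//.
by rewrite mulrACA.
Qed.

(** The truncation at [l] stops exactly at length [l.+1]; shorter words have likelihood zero. *)
Lemma sum_sqrt_lik_le l x x' :
  \sum_(w <- words_upto Y l.+2)
    Num.sqrt (lik S (trunc cyclic l) x w * lik S (trunc cyclic l) x' w) <=
  \prod_(i < l.+1) overlap S (cyclic_action i) x x'.
Proof.
rewrite -(sum_sqrt_path_prob x x' (leqnn l.+1)) words_uptoS big_cat /=.
rewrite big1_seq ?add0r => [|w].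
  apply: ler_sum => w _; apply: ler_wsqrtr.
  by apply: ler_pM; rewrite ?lik_ge0// /lik; case: ifP => // _; exact: path_prob_ge0.
rewrite mem_words_upto ltnS => /andP[_ wl].
by rewrite /lik /stopped (trunc_cyclicE l w) wl !andbF mul0r sqrtr0.
Qed.

(** An action separating [x] from [x'] recurs with period [#|Act|], each time contributing the same
    factor below 1. *)
Lemma prod_overlap_cvg0 x x' : ~~ indist S x x' ->
  (fun l => \prod_(i < l.+1) overlap S (cyclic_action i) x x') @ \oo --> (0 : R).
Proof.
move=> xx'.
have [a xa] : exists a, prob S a x <> prob S a x'.
  by apply/existsNP => h; move/negP: xx'; apply; exact/indistP.
have a_lt : (index a (enum Act) < #|Act|)%N by rewrite cardE index_mem mem_enum.
have Act0 : (0 < #|Act|)%N by apply: leq_ltn_trans a_lt.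
pose rho := overlap S a x x'.
have rho01 : 0 <= rho < 1 by rewrite overlap_ge0 overlap_lt1.
apply: (@squeeze_cvgr _ _ _ _ (fun=> 0) (fun l => rho ^+ (l.+1 %/ #|Act|))).
- near=> l; apply/andP; split; first by apply: prodr_ge0 => i _; exact: overlap_ge0.
  apply: (prod_periodic_le (b := fun i => overlap S (cyclic_action i) x x') _ a_lt).
    by move=> i; rewrite overlap_ge0 overlap_le1.
  by move=> n; rewrite /cyclic_action modnMDl modn_small// nth_index ?mem_enum.
- exact: cvg_cst.
- have := cvg_expr_divn rho01 Act0.
  by rewrite -(cvg_shiftS (fun k => rho ^+ (k %/ #|Act|))).
Unshelve. all: by end_near.
Qed.

End Cyclic.

(** * Leakage of arbitrary strategies and of the cyclic one *)

Section Main.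
Context (R : realType) (X Y Act : finType) (S : mechanism R X Y Act).
Context (U : (X -> R) -> R) (p : X -> R).
Context (hU : uncertainty_measure U) (pD : prob_distr R X p).

Lemma trunc_bounded (s : strategy Y Act) l w : trunc s l w != None -> (size w <= l)%N.
Proof. by rewrite /= /trunc_fun; case: ifP. Qed.

(** The case [g = 1] of [class_jensen]: the prior is the mixture of its own class conditionals. *)
Lemma class_info_ge0 : 0 <= class_info S U p.
Proof.
have := class_jensen (S := S) (g := fun=> 1) pD hU.1 (fun=> ler01) (fun _ _ _ => erefl).
rewrite /class_info subr_ge0 (cond_uncertaintyE _ _ pD) /=.
under eq_bigr do rewrite mulr1.
rewrite pD.2 => /(_ ltr01)[_].
under eq_bigr do rewrite mulr1.
rewrite mul1r; congr (_ <= U _).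
by apply/funext => x; rewrite mulr1 divr1.
Qed.

Lemma leak_le (s : strategy Y Act) : leak S U p s <= class_info S U p.
Proof.
rewrite /leak; case: asboolP => [/finite_strategy_bounded[n sn]|_].
  exact: leak_fin_le sn _ _ pD hU.1.
have [cv|dv] := pselect (cvgn (fun l => leak_fin S U p (trunc s l))).
  apply: limr_le => //; near=> l.
  exact: leak_fin_le (@trunc_bounded s l) _ _ pD hU.1.
(* A divergent sequence has the junk limit [0]; this spares the proof that
   [leak_fin (trunc s l)] is nondecreasing. *)
by rewrite (dvgP dv); exact: class_info_ge0.
Unshelve. all: by end_near.
Qed.

Lemma leak_cyclic a0 : leak S U p (cyclic Y a0) = class_info S U p.
Proof.
rewrite /leak; case: asboolP => [/finite_strategy_bounded[n sn]|_].
  (* The cyclic strategy is not finite: repeating a single observation gives words of any length in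
     its domain. *)
  have /card_gt0P[y _] := obs_neq0 S.
  by have := sn (nseq n.+1 y) isT; rewrite size_nseq ltnn.
apply: cvg_lim => //; apply/cvgrPdist_le => e e0.
(* Half of [e] pays for the continuity of [U], the other half for [err]. *)
have [K K0 KP] := leak_fin_ge S hU pD (divr_gt0 e0 (ltr0n _ 2)).
pose err l := \sum_x K x * \sum_(x' | ~~ indist S x x')
  \prod_(i < l.+1) overlap S (cyclic_action a0 i) x x'.
have err0 : err @ \oo --> (0 : R).
  have -> : 0 = \sum_x K x * \sum_(x' | ~~ indist S x x') 0 :> R.
    by rewrite big1// => x _; rewrite big1 ?mulr0.
  apply: cvg_big => [|x _]; first exact: add_continuous.
  apply: cvgMr; apply: cvg_big => [|x']; first exact: add_continuous.
  exact: prod_overlap_cvg0.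
near=> l.
have low := KP _ _ (@trunc_bounded (cyclic Y a0) l).
have up := leak_fin_le S (@trunc_bounded (cyclic Y a0) l) pD hU.1.
rewrite ger0_norm ?subr_ge0//.
have errl : err l <= e / 2.
  near: l; move/cvgrPdist_le : err0 => /(_ (e / 2) (divr_gt0 e0 (ltr0n _ 2))).
  apply: filterS => l; rewrite sub0r normrN; exact: le_trans (ler_norm _).
have : \sum_x K x * \sum_(x' | ~~ indist S x x') \sum_(w <- words_upto Y l.+2)
    Num.sqrt (lik S (trunc (cyclic Y a0) l) x w * lik S (trunc (cyclic Y a0) l) x' w)
    <= err l.
  apply: ler_sum => x _; rewrite ler_wpM2l//; apply: ler_sum => x' _.
  exact: sum_sqrt_lik_le.
lra.
Unshelve. all: by end_near.
Qed.

End Main.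

Theorem theorem5p5 (R : realType) (X Y Act : finType)
    (S : mechanism R X Y Act) (U : (X -> R) -> R)
    (hU : uncertainty_measure U) (p : X -> R) (hp : prob_distr R X p) :
  (exists s : strategy Y Act,
     [/\ total_strategy s, non_adaptive s & leak S U p s = class_info S U p])
  /\ leak_star S U p = (class_info S U p)%:E.
Proof.
have /card_gt0P[a0 _] := act_neq0 S.
have leakE := leak_cyclic S hU hp a0.
split.
  exists (cyclic Y a0); split => //; last exact: cyclic_non_adaptive.
  exact: cyclic_total.
apply/eqP; rewrite eq_le; apply/andP; split.
  by apply: ge_ereal_sup => _ [s _ <-]; rewrite lee_fin; exact: leak_le.
by apply: ereal_sup_ubound; exists (cyclic Y a0); rewrite ?leakE.
Qed.
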